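(* Let $r,s,t$ and $n$ be positive integers. Then $$\sum_{k=-n}^{n}(-1)^k\binom{6n}{3n+k}^r\binom{4n}{2n+k}^s\binom{2n}{n+k}^t\equiv 0\pmod{2\binom{6n}{n}}$$ and $$\sum_{k=-n}^{n}(-1)^k\binom{6n}{3n+k}^r\binom{4n}{2n+k}^s\binom{2n}{n+k}^t\equiv 0\pmod{6\binom{6n}{3n}}.$$ Furthermore, if $(r,s,t)\neq(1,1,1)$, then $$\sum_{k=-n}^{n}(-1)^k\binom{8n}{4n+k}^r\binom{4n}{2n+k}^s\binom{2n}{n+k}^t\equiv 0\pmod{2\binom{8n}{3n}}.$$
   Context: All congruences are between integers; the binomial coefficients are the ordinary ones. *)

(* Defs.v *)
From mathcomp Require Import all_boot all_order all_algebra.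
Set Implicit Arguments.
Unset Strict Implicit.
Unset Printing Implicit Defensive.
Import Order.TTheory GRing.Theory Num.Theory.
Local Open Scope ring_scope.

(* The integers a, a + 1, ..., b in increasing order; empty when b < a. *)
Definition zrange (a b : int) : seq int :=
  if a <= b then [seq a + i%:Z | i <- iota 0 `|b - a|%N.+1] else [::].

Lemma mem_zrange (a b k : int) : (k \in zrange a b) = (a <= k <= b).
Proof.
rewrite /zrange; case: ifPn => [leab|]; last first.
  move=> nab; rewrite in_nil; apply/esym/negbTE.
  by apply: contra nab => /andP[]; exact: le_trans.
have eab : `|b - a|%N%:Z = b - a by rewrite gez0_abs // subr_ge0.
apply/mapP/andP => [[i] | [leak lekb]].
  rewrite mem_iota /= add0n ltnS => lei ->; rewrite lerDl; split=> //.
  by rewrite -lerBrDl -eab lez_nat.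
exists `|k - a|%N; last by rewrite gez0_abs ?subr_ge0 // subrKC.
rewrite mem_iota /= add0n ltnS -lez_nat eab gez0_abs ?subr_ge0 //.
by rewrite lerD2r.
Qed.

Lemma uniq_zrange (a b : int) : uniq (zrange a b).
Proof.
rewrite /zrange; case: ifP => // _; rewrite map_inj_uniq ?iota_uniq //.
by move=> i j /addrI[].
Qed.

(* Binomial coefficient with an integer lower index, zero when it is
   negative. *)
Definition zbin (m : nat) (k : int) : int :=
  if k is Posz j then 'C(m, j)%:Z else 0.

(* Main.v *)
Require Import Defs.
From mathcomp Require Import all_boot all_order all_algebra.
From mathcomp Require Import zify ring.
Set Implicit Arguments.
Unset Strict Implicit.
Unset Printing Implicit Defensive.
Import Order.TTheory GRing.Theory Num.Theory.

(** Up to factorials, the product of powers of [binom(2a, a+k)] is a product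
of [1 / ((a-k)! (a+k)!)] over a list [a_1, ..., a_m], which may be put in any
order.  Vandermonde's identity expands the factors of [a_1] and [a_2] into
those of a single [u <= a_1]; iterating gives a formula for the alternating
sum as an explicit binomial coefficient times the nonnegative integer
[dixsum], a multiple sum over [a_1 >= u_1 >= u_2 >= ...] of products of
[binom(u_(i-1), u_i) binom(a_(i+1) + a_(i+2), a_(i+2) + u_i)].

The extra factors 2 and 3 divide [dixsum] term by term for a suitable order of
the list: [binom(N, j)] is divisible by the prime [p] when [p^e] divides [N]
but not [j].  So if [p^e] divides [a_1], in the remaining terms it divides
every [u_i], and then a pair of neighbours with [p^e | a_i + a_(i+1)] and
[p^e] not dividing [a_i] contributes a binomial coefficient divisible by [p].
The list [2n, n, 4n, ..., 4n] has no such pair; there one summation is carried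
out in closed form first. *)

(** * Prime divisors of binomial coefficients *)

(** If [p] did not divide ['C(a, b)], then [p ^ e] would be coprime to it, and
    [b * 'C(a, b) = a * 'C(a.-1, b.-1)] would force [p ^ e] to divide [b]. *)
Lemma prime_dvd_bin_expn p e a b :
  prime p -> p ^ e %| a -> ~~ (p ^ e %| b) -> p %| 'C(a, b).
Proof.
move=> p_pr da db; case: b db => [|b] db; first by rewrite dvdn0 in db.
apply: contraR db => nC; have cop : coprime (p ^ e) 'C(a, b.+1).
  by rewrite coprimeXl // prime_coprime.
rewrite -(Gauss_dvdl _ cop); case: a da {nC cop} => [|a] da.
  by rewrite bin0n muln0 dvdn0.
by rewrite -mul_bin_diag dvdn_mulr.
Qed.

(** Vandermonde along [a = q * p ^ e + a %% p ^ e]: if [p ^ e] does not divide [j], then [p] divides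
    the first factor; otherwise [b - j >= b %% p ^ e] and the second factor is zero. *)
Lemma prime_dvd_bin_modn p e a b :
  prime p -> a %% p ^ e < b %% p ^ e -> p %| 'C(a, b).
Proof.
move=> p_pr lt_ab; rewrite {1}(divn_eq a (p ^ e)) -binomial.Vandermonde.
apply: dvdn_sum => -[j /= lt_jb] _.
have [dj|ndj] := boolP (p ^ e %| j); last first.
  by rewrite dvdn_mulr // (prime_dvd_bin_expn p_pr _ ndj) // dvdn_mull.
rewrite [X in _ * X]bin_small ?muln0 //; apply: leq_trans lt_ab _.
case/dvdnP: dj lt_jb => q -> lt_jb; rewrite ltnS in lt_jb.
rewrite -{1}(subnKC lt_jb) modnMDl; exact: leq_mod.
Qed.

(** * The multiple sum and its prime divisors *)

(* The value at [::] makes [altsum_dixsum] hold for one-element lists too. *)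
Fixpoint dixsum (a : nat) (l : seq nat) : nat :=
  if l is b :: l' then
    if l' is c :: _ then
      \sum_(s < a.+1) 'C(a, s) * 'C(b + c, c + s) * dixsum s l'
    else 1
  else (a == 0).

Arguments dixsum : simpl never.

Lemma dixsum_cons2 a b c l :
  dixsum a [:: b, c & l] =
  \sum_(s < a.+1) 'C(a, s) * 'C(b + c, c + s) * dixsum s (c :: l).
Proof. by []. Qed.

Lemma prime_dvd_dixsum p e a l1 x y l2 : prime p -> p ^ e %| a ->
  p ^ e %| x + y -> ~~ (p ^ e %| x) -> p %| dixsum a (l1 ++ [:: x, y & l2]).
Proof.
move=> p_pr; elim: l1 a => [|b l1 IH] a da dxy ndx.
  rewrite cat0s dixsum_cons2; apply: dvdn_sum => -[s /= _] _.
  have [ds|nds] := boolP (p ^ e %| s); last first.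
    by rewrite -mulnA dvdn_mulr // (prime_dvd_bin_expn p_pr da nds).
  rewrite mulnAC dvdn_mull // (prime_dvd_bin_expn p_pr dxy) //.
  by apply: contra ndx => dys; rewrite -(dvdn_addl _ dys) addnA dvdn_add.
have [c [l' El]] : exists c l', l1 ++ [:: x, y & l2] = c :: l'.
  by case: (l1) => [|c l']; do 2!eexists.
move: (IH); rewrite cat_cons El => {}IH; rewrite dixsum_cons2.
apply: dvdn_sum => -[s /= _] _.
have [ds|nds] := boolP (p ^ e %| s); first by rewrite dvdn_mull ?IH.
by rewrite -mulnA dvdn_mulr // (prime_dvd_bin_expn p_pr da nds).
Qed.

Lemma sum_bin_shift a m c :
  \sum_(j < a.+1) 'C(a, j) * 'C(m, c + j) = 'C(a + m, c + a).
Proof.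
elim: a c => [|a IH] c.
  by rewrite big_ord_recl big_ord0 bin0 mul1n !addn0 add0n.
rewrite addSn addnS binS -addSn -!IH.
rewrite big_ord_recl /= bin0 mul1n addn0.
under eq_bigr => i _ do rewrite /bump /= add1n binS mulnDl addnS -addSn.
rewrite big_split /= addnA addnC; congr (_ + _).
rewrite big_ord_recr /= (@bin_small a a.+1) // mul0n addn0.
rewrite [RHS]big_ord_recl /= bin0 mul1n addn0; congr (_ + _).
by apply: eq_bigr => i _; rewrite /bump /= add1n addSn addnS.
Qed.

(** By ['C(a, s) * 'C(s, u) = 'C(a, u) * 'C(a - u, s - u)], the sum reduces to the shifted
    Vandermonde sum. *)
Lemma sum_bin_trinomial a m c u : u <= a ->
  \sum_(s < a.+1) 'C(a, s) * 'C(s, u) * 'C(m, c + s)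
    = 'C(a, u) * 'C(a - u + m, c + a).
Proof.
move=> le_ua; rewrite -(big_mkord xpredT (fun s => 'C(a, s) * 'C(s, u) * 'C(m, c + s))).
rewrite (big_cat_nat (leq0n u) (leqW le_ua)) /=.
rewrite big_nat_cond big1 ?add0n => [|s]; last first.
  by rewrite andbT => lt_su; rewrite (bin_small lt_su) muln0.
rewrite -{1}[u]add0n big_addn big_mkord subSn //.
transitivity ('C(a, u) * \sum_(j < (a - u).+1) 'C(a - u, j) * 'C(m, (c + u) + j)).
  rewrite big_distrr /=; apply: eq_bigr => -[j /= lt_j] _.
  rewrite mulnA -addnA [u + j]addnC; congr (_ * _).
  have le_ja : j + u <= a by lia.
  have f0 : 0 < u`! * j`! * (a - (j + u))`! by rewrite !muln_gt0 !fact_gt0.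
  apply/eqP; rewrite -(eqn_pmul2r f0); apply/eqP.
  have := bin_fact le_ja; have := bin_fact (leq_addl j u); rewrite addnK.
  have := bin_fact le_ua; have/bin_fact : j <= a - u by lia.
  by rewrite -subnDA addnC => E1 E2 E3 E4; nia.
by rewrite sum_bin_shift -addnA subnKC.
Qed.

(** Exchanging the first two summations lets the outer index be summed in closed form. *)
Lemma dixsum_cons3 a b c c' l :
  dixsum a [:: b, c, c' & l] =
  \sum_(u < a.+1)
    'C(a, u) * 'C(a - u + (b + c), c + a) * 'C(c + c', c' + u) * dixsum u (c' :: l).
Proof.
rewrite dixsum_cons2.
transitivity (\sum_(s < a.+1) \sum_(u < a.+1)
   'C(a, s) * 'C(s, u) * 'C(b + c, c + s) * ('C(c + c', c' + u) * dixsum u (c' :: l))).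
  apply: eq_bigr => -[s /= lt_sa] _; rewrite dixsum_cons2 big_distrr /=.
  rewrite [LHS](big_ord_widen _ (fun u => 'C(a, s) * 'C(b + c, c + s) *
     ('C(s, u) * 'C(c + c', c' + u) * dixsum u (c' :: l))) lt_sa) big_mkcond /=.
  apply: eq_bigr => u _; case: ltnP => [_|lt_su]; first by rewrite !mulnA; lia.
  by rewrite (bin_small lt_su) muln0 !mul0n.
rewrite exchange_big /=; apply: eq_bigr => -[u /= lt_u] _.
by rewrite -big_distrl /= sum_bin_trinomial // !mulnA.
Qed.

(** The useful pair of neighbours is the junction of the blocks of [b] and [c]. *)
Lemma prime_dvd_dixsum_blocks p e a b c r s t : prime p -> p ^ e %| a ->
  p ^ e %| b + c -> ~~ (p ^ e %| b) ->
  p %| dixsum a (nseq r a ++ nseq s.+1 b ++ nseq t.+1 c).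
Proof.
have -> : nseq s.+1 b = nseq s b ++ [:: b] by rewrite cats1; elim: s => //= s <-.
by rewrite -catA catA /=; apply: prime_dvd_dixsum.
Qed.

Lemma even_dixsum_2_1_4 n r : 0 < n -> 2 %| dixsum (2 * n) (n :: nseq r.+2 (4 * n)).
Proof.
move=> n_gt0; have [m] := pfactor_coprime (isT : prime 2) n_gt0.
rewrite coprime2n; move: (logn 2 n) => e m_odd En.
have q_gt0 : 0 < 2 ^ e by rewrite expn_gt0.
rewrite dixsum_cons3; apply: dvdn_sum => -[u /=]; rewrite ltnS => le_u _.
apply: dvdn_mulr.
(* [2 ^ (e + 3)] divides [8 * n], so ['C(8 * n, 4 * n + u)] is even unless it also divides
   [4 * n + u]. *)
have [d8|nd8] := boolP (2 ^ (e + 3) %| 4 * n + u); last first.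
  apply/dvdn_mull/(prime_dvd_bin_expn (e := e + 3)) => //.
  by rewrite En expnD; apply/dvdnP; exists m; lia.
apply: dvdn_mulr.
have [w [w_odd Eu]] : exists w, odd w /\ u = 4 * 2 ^ e * w.
  case/dvdnP: d8 => v; rewrite expnD En => Ev.
  exists (2 * v - m); split; nia.
(* The residue of [m] decides which factor is even: ['C(2 * n, u)] for 1, the closed-form factor
   ['C(7 * n - u, 6 * n)] for 3. *)
have [m1|m3] : m %% 4 = 1 \/ m %% 4 = 3 by lia.
  apply/dvdn_mulr/(prime_dvd_bin_modn (e := e + 3)) => //.
  have -> : 2 * n = 2 * 2 ^ e * m by lia.
  have -> : 2 ^ (e + 3) = 2 * 2 ^ e * 4 by rewrite expnD; lia.
  rewrite -muln_modr m1 Eu.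
  have -> : 2 * 2 ^ e * 4 = 4 * 2 ^ e * 2 by lia.
  by rewrite -muln_modr modn2 w_odd; lia.
apply/dvdn_mull/(prime_dvd_bin_modn (e := e + 2)) => //.
have -> : 2 ^ (e + 2) = 2 ^ e * 4 by rewrite expnD.
have le_wm : 2 * w <= m by nia.
have -> : 2 * n - u + (n + 4 * n) = 2 ^ e * (7 * m - 4 * w) by nia.
have -> : 4 * n + 2 * n = 2 ^ e * (6 * m) by lia.
rewrite -!muln_modr ltn_pmul2l //; lia.
Qed.

Local Open Scope ring_scope.

(** * Products of reciprocal factorials *)

Lemma natr_fact_neq0 n : (n`!)%:R != 0 :> rat.
Proof. by rewrite pnatr_eq0 -lt0n fact_gt0. Qed.

Lemma natr_bin n m : (m <= n)%N ->
  'C(n, m)%:R = (n`!)%:R / ((m`!)%:R * ((n - m)`!)%:R) :> rat.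
Proof.
move=> le_mn; apply: (canRL (mulfK _)); first by rewrite mulf_neq0 ?natr_fact_neq0.
by rewrite -!natrM bin_fact.
Qed.

(** The binomial form makes [1 / ((a-k)! (a+k)!)] vanish for [k > a]. *)
Definition symrecip (a k : nat) : rat := 'C(2 * a, a + k)%:R / ((2 * a)`!)%:R.

Lemma symrecipE a k : (k <= a)%N -> symrecip a k = (((a - k)`!)%:R * ((a + k)`!)%:R)^-1.
Proof.
move=> le_ka; rewrite /symrecip natr_bin; last by lia.
have -> : (2 * a - (a + k) = a - k)%N by lia.
by field; rewrite !natr_fact_neq0.
Qed.

Lemma symrecip_small a k : (a < k)%N -> symrecip a k = 0.
Proof. by move=> lt_ak; rewrite /symrecip bin_small ?mul0r //; lia. Qed.

(** This is [1 / ((a-s)! (b-s)! (a+b)!)], extended by zero to [s] above [a] or [b]. *)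
Definition vdm_coef (a b s : nat) : rat :=
  ('C(a, s) * 'C(b, s) * s`! ^ 2)%:R / (a`! * b`! * (a + b)`!)%:R.

(** Vandermonde for ['C(a + b, a - k)], split as [(b - k) + (a + k)], with [s = j + k]. *)
Lemma symrecip_mul a b k :
  symrecip a k * symrecip b k = \sum_(s < a.+1) vdm_coef a b s * symrecip s k.
Proof.
have [lt_ak|le_ka] := ltnP a k.
  rewrite symrecip_small // mul0r big1 // => -[s /= lt_s] _.
  by rewrite symrecip_small ?mulr0 //; lia.
have [lt_bk|le_kb] := ltnP b k.
  rewrite (symrecip_small lt_bk) mulr0 big1 // => -[s /= lt_s] _.
  have [lt_sk|le_ks] := ltnP s k; first by rewrite symrecip_small ?mulr0.
  by rewrite /vdm_coef (@bin_small b) ?muln0 ?mul0r //; lia.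
rewrite -(big_mkord xpredT (fun s => vdm_coef a b s * symrecip s k)).
rewrite (big_cat_nat (leq0n k) (leqW le_ka)) /=.
rewrite big_nat_cond big1 ?add0r => [|s]; last first.
  by rewrite andbT => lt_sk; rewrite symrecip_small ?mulr0.
rewrite -[X in index_iota X _]add0n big_addn big_mkord subSn //.
transitivity ('C(b - k + (a + k), a - k)%:R /
              (((b - k)`!)%:R * ((a + k)`!)%:R * ((a + b)`!)%:R) : rat).
  rewrite natr_bin; last by lia.
  have -> : (b - k + (a + k) = a + b)%N by lia.
  have -> : (a + b - (a - k) = b + k)%N by lia.
  by rewrite !symrecipE //; field; rewrite !natr_fact_neq0.
rewrite -binomial.Vandermonde natr_sum mulr_suml.
apply: eq_bigr => -[j /= lt_j] _.
have [lt_bj|le_jb] := ltnP (b - k) j.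
  by rewrite bin_small // /vdm_coef (@bin_small b) ?muln0 ?mul0n ?mul0r //; lia.
rewrite /vdm_coef symrecipE; last by lia.
rewrite !natrM !natr_bin; try by lia.
have -> : (j + k - k = j)%N by lia.
have -> : (b - k - j = b - (j + k))%N by lia.
have -> : (a + k - (a - k - j) = j + k + k)%N by lia.
have -> : (a - k - j = a - (j + k))%N by lia.
by field; rewrite !natr_fact_neq0.
Qed.

(** * The alternating sum as a multiple sum *)

(* Weight of the pair {k, -k} in the alternating sum over all integers. *)
Definition altw (k : nat) : int := (-1) ^+ k * (k != 0).+1%:Z.

Definition altsum (K : nat) (l : seq nat) : rat :=
  \sum_(k < K.+1) (altw k)%:~R * \prod_(a <- l) symrecip a k.

Lemma altsum_cons2 K a b l :
  altsum K [:: a, b & l] = \sum_(s < a.+1) vdm_coef a b s * altsum K ((s : nat) :: l).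
Proof.
rewrite /altsum; under [RHS]eq_bigr do rewrite mulr_sumr.
rewrite exchange_big /=; apply: eq_bigr => k _.
rewrite !big_cons mulrA symrecip_mul mulr_suml mulr_sumr.
by apply: eq_bigr => s _; rewrite big_cons; ring.
Qed.

(** Partial sums telescope by Pascal's rule; the closed form vanishes once [K > a]. *)
Lemma sum_altw_bin a K :
  \sum_(k < K.+1) altw k * 'C(2 * a.+1, a.+1 + k)%:Z =
  2 * (-1) ^+ K * 'C((2 * a).+1, a.+1 + K)%:Z.
Proof.
elim: K => [|K IH].
  rewrite big_ord_recl big_ord0 /altw /= addr0 !expr0 !mul1r addn0.
  have -> : (2 * a.+1 = (2 * a).+2)%N by lia.
  rewrite binS PoszD -(@bin_sub (2 * a).+1 a); last by lia.
  have -> : ((2 * a).+1 - a = a.+1)%N by lia.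
  by ring.
rewrite big_ord_recr IH /= /altw /=.
have -> : (2 * a.+1 = (2 * a).+2)%N by lia.
rewrite !addnS binS PoszD exprS; ring.
Qed.

Lemma altsum1 a K : (a <= K)%N -> altsum K [:: a] = (a == 0)%:R.
Proof.
case: a => [_|a lt_aK].
  rewrite /altsum big_ord_recl big_seq1 /= big1 => [|k _].
    by rewrite addr0 /altw /symrecip /= !mul1r.
  by rewrite big_seq1 symrecip_small ?mulr0.
rewrite /altsum.
under eq_bigr do rewrite big_seq1 /symrecip mulrA pmulrn -intrM.
rewrite -mulr_suml -rmorph_sum /= sum_altw_bin bin_small; last by lia.
by rewrite mulr0 mul0r.
Qed.

Fixpoint pathfact (a : nat) (l : seq nat) : nat :=
  if l is b :: l' then ((a + b)`! * pathfact b l')%N else 1%N.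

Lemma pathfact_gt0 a l : (0 < pathfact a l)%N.
Proof. by elim: l a => //= b l IH a; rewrite muln_gt0 fact_gt0 IH. Qed.

Lemma altsum_dixsum a l K : (a <= K)%N ->
  altsum K (a :: l) * (a`! * (last a l)`! * pathfact a l)%:R = (dixsum a l)%:R.
Proof.
elim: l a => [|b l IH] a le_aK.
  by rewrite altsum1 //; case: a {le_aK} => [|a]; rewrite ?mul0r ?mul1r.
rewrite altsum_cons2 mulr_suml; case: l IH => [|c l] IH.
  (* With two entries left, only [s = 0] survives, since [altsum K [:: s]] vanishes for [s > 0]. *)
  rewrite big_ord_recl big1 => [|s _]; last first.
    by rewrite lift0 altsum1 ?mulr0 ?mul0r // (leq_trans (ltn_ord s)).
  rewrite altsum1 // /vdm_coef !bin0 /= !natrM addr0 mulr1.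
  by field; rewrite !natr_fact_neq0.
rewrite dixsum_cons2 natr_sum; apply: eq_bigr => -[s /= lt_sa] _.
have [lt_bs|le_sb] := ltnP b s.
  by rewrite /vdm_coef (@bin_small b) // (@bin_small (b + c)) ?muln0 ?mul0n ?mul0r //; lia.
have Pn0 := pathfact_gt0 c l; rewrite lt0n -(pnatr_eq0 rat) in Pn0.
rewrite [RHS]natrM -(IH s) /=; last by lia.
rewrite /vdm_coef !natrM !natr_bin; try by lia.
have -> : (b + c - (c + s) = b - s)%N by lia.
rewrite [(s + c)%N]addnC.
by field; rewrite !natr_fact_neq0.
Qed.

Lemma pathfact_cat a l1 l2 :
  pathfact a (l1 ++ l2) = (pathfact a l1 * pathfact (last a l1) l2)%N.
Proof. by elim: l1 a => [|b l1 IH] a /=; rewrite ?mul1n // IH mulnA. Qed.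

Lemma pathfact_nseq a r : pathfact a (nseq r a) = ((2 * a)`! ^ r)%N.
Proof. by elim: r => //= r ->; rewrite expnS mul2n addnn. Qed.

Lemma last_nseq (T : Type) (a : T) r : last a (nseq r a) = a.
Proof. by elim: r. Qed.

(** * Sums with three blocks of equal entries *)

Definition trisum (K a r b s c t : nat) : int :=
  \sum_(k < K.+1) altw k * 'C(2 * a, a + k)%:Z ^+ r
    * 'C(2 * b, b + k)%:Z ^+ s * 'C(2 * c, c + k)%:Z ^+ t.

Lemma trisum_swap12 K a r b s c t : trisum K a r b s c t = trisum K b s a r c t.
Proof. by apply: eq_bigr => k _; ring. Qed.

Lemma trisum_swap23 K a r b s c t : trisum K a r b s c t = trisum K a r c t b s.
Proof. by apply: eq_bigr => k _; ring. Qed.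

(** Allows the list to start with an entry larger than [n], where [altsum_dixsum] needs a longer
    range. *)
Lemma trisum_widen K n a r b s t : (n <= K)%N ->
  trisum K a r b s n t.+1 = trisum n a r b s n t.+1.
Proof.
move=> le_nK; rewrite /trisum [RHS](big_ord_widen _ (fun k : nat =>
  altw k * 'C(2 * a, a + k)%:Z ^+ r * 'C(2 * b, b + k)%:Z ^+ s
    * 'C(2 * n, n + k)%:Z ^+ t.+1) (_ : n.+1 <= K.+1)%N) // [RHS]big_mkcond.
apply: eq_bigr => -[k /= _] _; case: ltnP => // lt_nk.
by rewrite (@bin_small (2 * n)) ?expr0n ?mulr0 //; lia.
Qed.

Lemma trisum_altsum K a r b s c t :
  (trisum K a r b s c t)%:~R =
  ((2 * a)`! ^ r * (2 * b)`! ^ s * (2 * c)`! ^ t)%:R *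
  altsum K (nseq r a ++ nseq s b ++ nseq t c).
Proof.
rewrite /altsum mulr_sumr rmorph_sum; apply: eq_bigr => k _ /=.
rewrite !big_cat !big_nseq !natrM !natrX !rmorphM !rmorphXn /=.
have E x : 'C(2 * x, x + k)%:~R = ((2 * x)`!)%:R * symrecip x k :> rat.
  by rewrite /symrecip mulrC divfK ?natr_fact_neq0.
by rewrite !iter_mulr_1 !E; move: (symrecip _ _) (symrecip _ _) (symrecip _ _) => *; rewrite !exprMn; ring.
Qed.

Lemma trisum_dixsum K a r b s c t : (a <= K)%N ->
  trisum K a r.+1 b s.+1 c t.+1 * (a`! * c`! * (a + b)`! * (b + c)`!)%N%:Z =
  (dixsum a (nseq r a ++ nseq s.+1 b ++ nseq t.+1 c)
     * ((2 * a)`! * (2 * b)`! * (2 * c)`!))%N%:Z.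
Proof.
move=> le_aK; apply: (@intr_inj rat); rewrite intrM trisum_altsum -!pmulrn.
rewrite [in RHS]natrM -(altsum_dixsum _ le_aK) /=.
rewrite !(last_cat, last_nseq, pathfact_cat) /=.
rewrite !(last_cat, last_nseq, pathfact_cat) /= last_nseq.
rewrite !pathfact_nseq !expnS !natrM !natrX; ring.
Qed.

Lemma dvd_trisum d B K a r b s c t : (a <= K)%N ->
  (B * (a`! * c`! * (a + b)`! * (b + c)`!) = (2 * a)`! * (2 * b)`! * (2 * c)`!)%N ->
  (d %| dixsum a (nseq r a ++ nseq s.+1 b ++ nseq t.+1 c))%N ->
  ((d * B)%N%:Z %| trisum K a r.+1 b s.+1 c t.+1)%Z.
Proof.
move=> le_aK EB /dvdnP[q Eq]; have := trisum_dixsum r b s c t le_aK.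
rewrite -EB Eq mulnA [RHS]PoszM => /mulIf -> //.
  by rewrite -mulnA PoszM dvdz_mull.
by rewrite eqz_nat -lt0n !muln_gt0 !fact_gt0.
Qed.

(** * Folding the sum over [k] and [-k] *)

Lemma sum_zrange_sym (F : int -> int) n :
  \sum_(k <- zrange (- n%:Z) n%:Z) F k =
  F 0 + \sum_(k < n) (F k.+1%:Z + F (- k.+1%:Z)).
Proof.
elim: n => [|n IH]; first by rewrite big_ord0 addr0 /zrange /= big_seq1.
have P : perm_eq (zrange (- n.+1%:Z) n.+1%:Z)
                 [:: n.+1%:Z, - n.+1%:Z & zrange (- n%:Z) n%:Z].
  apply: uniq_perm; rewrite ?uniq_zrange //=.
    by rewrite !(in_cons, mem_zrange) uniq_zrange; lia.
  by move=> k; rewrite mem_zrange 2!in_cons mem_zrange; lia.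
by rewrite (perm_big _ P) /= !big_cons IH big_ord_recr /=; ring.
Qed.

Lemma sum_zrange_trisum n a r b s c t : (n <= a)%N -> (n <= b)%N -> (n <= c)%N ->
  \sum_(k <- zrange (- n%:Z) n%:Z)
     (-1) ^ k * zbin (2 * a) (a%:Z + k) ^+ r
              * zbin (2 * b) (b%:Z + k) ^+ s
              * zbin (2 * c) (c%:Z + k) ^+ t = trisum n a r b s c t.
Proof.
move=> le_na le_nb le_nc; rewrite sum_zrange_sym /trisum big_ord_recl /=.
congr (_ + _).
apply: eq_bigr => -[k /= lt_kn] _; rewrite /bump /= add1n.
have N x : (n <= x)%N -> zbin (2 * x) (x%:Z - k.+1%:Z) = 'C(2 * x, x + k.+1).
  move=> le_nx; have le_kx : (k.+1 <= x)%N by lia.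
  rewrite subzn //= -(@bin_sub _ (x - k.+1)); last by lia.
  by congr (Posz 'C(_, _)); lia.
rewrite !N // -exprnN -!exprnP /altw /= -exprVn invrN1; ring.
Qed.

(** * The three divisibility results *)

Lemma pfactor_dvdn_mul p n m : prime p -> (0 < n)%N -> (p %| m)%N ->
  (p ^ (logn p n).+1 %| m * n)%N.
Proof. by move=> p_pr n0 dm; rewrite expnS dvdn_mul ?pfactor_dvdnn. Qed.

Lemma pfactor_ndvdn_mul p n m : prime p -> (0 < n)%N -> ~~ (p %| m)%N ->
  ~~ (p ^ (logn p n).+1 %| m * n)%N.
Proof.
move=> p_pr n0 nd; rewrite Gauss_dvdr ?pfactor_dvdn ?ltnn //.
by rewrite coprimeXl // prime_coprime.
Qed.

(** Order [2n, 3n, n]: the junction sum [3n + n = 4n] has more factors 2 than [3n]. *)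
Lemma dvd_trisum_6n_n n r s t : (0 < n)%N ->
  ((2 * 'C(6 * n, n))%N%:Z %| trisum n (3 * n) r.+1 (2 * n) s.+1 n t.+1)%Z.
Proof.
move=> n0; rewrite -(@trisum_widen (2 * n)); last by lia.
rewrite trisum_swap12; apply: dvd_trisum => //.
  have := @bin_fact (6 * n) n; have -> : (6 * n - n = 5 * n)%N by lia.
  have -> : (2 * (2 * n) = 4 * n)%N by lia.
  have -> : (2 * (3 * n) = 6 * n)%N by lia.
  have -> : (2 * n + 3 * n = 5 * n)%N by lia.
  have -> : (3 * n + n = 4 * n)%N by lia.
  by move=> <-; lia.
apply: (@prime_dvd_dixsum_blocks 2 (logn 2 n).+1) => //.
- exact: pfactor_dvdn_mul.
- by rewrite -[X in (_ + X)%N]mul1n -mulnDl pfactor_dvdn_mul.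
- exact: pfactor_ndvdn_mul.
Qed.

(** Order [2n, n, 3n] gives the factor 2, order [3n, n, 2n] the factor 3, both with the same
    binomial coefficient. *)
Lemma dvd_trisum_6n_3n n r s t : (0 < n)%N ->
  ((6 * 'C(6 * n, 3 * n))%N%:Z %| trisum n (3 * n) r.+1 (2 * n) s.+1 n t.+1)%Z.
Proof.
move=> n0; set T := trisum _ _ _ _ _ _ _; set B := 'C(_, _).
have B0 : B != 0%N by rewrite -lt0n bin_gt0; lia.
have EB : (B * ((3 * n)`! * (3 * n)`!) = (6 * n)`!)%N.
  have := @bin_fact (6 * n) (3 * n); have -> : (6 * n - 3 * n = 3 * n)%N by lia.
  by apply; lia.
have E4 : (2 * (2 * n) = 4 * n)%N by lia.
have E6 : (2 * (3 * n) = 6 * n)%N by lia.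
have d2 : ((2 * B)%N%:Z %| T)%Z.
  rewrite /T -(@trisum_widen (2 * n)); last by lia.
  rewrite trisum_swap12 trisum_swap23; apply: dvd_trisum => //.
    have -> : (2 * n + n = 3 * n)%N by lia.
    have -> : (n + 3 * n = 4 * n)%N by lia.
    by rewrite E4 E6 -EB; lia.
  apply: (@prime_dvd_dixsum_blocks 2 (logn 2 n).+1) => //.
  - exact: pfactor_dvdn_mul.
  - by rewrite -{2}[n]mul1n -mulnDl pfactor_dvdn_mul.
  - by rewrite -{2}[n]mul1n pfactor_ndvdn_mul.
have d3 : ((3 * B)%N%:Z %| T)%Z.
  rewrite /T -(@trisum_widen (3 * n)); last by lia.
  rewrite trisum_swap23; apply: dvd_trisum => //.
    have -> : (3 * n + n = 4 * n)%N by lia.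
    have -> : (n + 2 * n = 3 * n)%N by lia.
    by rewrite E4 E6 -EB; lia.
  apply: (@prime_dvd_dixsum_blocks 3 (logn 3 n).+1) => //.
  - exact: pfactor_dvdn_mul.
  - by rewrite -{2}[n]mul1n -mulnDl pfactor_dvdn_mul.
  - by rewrite -{2}[n]mul1n pfactor_ndvdn_mul.
case/dvdzP: d2 => x Ex; case/dvdzP: d3 => y Ey.
have Exy : 2 * x = 3 * y.
  apply: (@mulIf _ B%:Z); first by rewrite eqz_nat.
  move: Ey; rewrite Ex !PoszM; lia.
(* From [T = 2Bx = 3By] follows [6B(x - y) = 3T - 2T = T]. *)
by apply/dvdzP; exists (x - y); rewrite Ex !PoszM; nia.
Qed.

(** If [n] or [2n] is repeated, order [4n, n, 2n] has two equal neighbours, whose sum gains a factor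
    2. Otherwise [4n] is repeated and order [2n, n, 4n] falls under [even_dixsum_2_1_4]. *)
Lemma dvd_trisum_8n_3n n r s t : (0 < n)%N ->
  (r.+1, s.+1, t.+1) <> (1, 1, 1)%N ->
  ((2 * 'C(8 * n, 3 * n))%N%:Z %| trisum n (4 * n) r.+1 (2 * n) s.+1 n t.+1)%Z.
Proof.
move=> n0 neq1; set B := 'C(_, _).
have EB : (B * ((3 * n)`! * (5 * n)`!) = (8 * n)`!)%N.
  have := @bin_fact (8 * n) (3 * n); have -> : (8 * n - 3 * n = 5 * n)%N by lia.
  by apply; lia.
have E4 : (2 * (2 * n) = 4 * n)%N by lia.
have E8 : (2 * (4 * n) = 8 * n)%N by lia.
have E3 : (2 * n + n = 3 * n)%N by lia.
have E5 : (4 * n + n = 5 * n)%N by lia.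
case: (posnP (s + t)) => [/eqP|st0].
  rewrite addn_eq0 => /andP[/eqP s0 /eqP t0]; subst s t.
  case: r neq1 => [|r _]; first by case.
  rewrite -(@trisum_widen (2 * n)); last by lia.
  rewrite trisum_swap12 trisum_swap23; apply: dvd_trisum => //.
    by rewrite E3 [(n + _)%N]addnC E5 E4 E8 -EB; lia.
  exact: even_dixsum_2_1_4.
rewrite -(@trisum_widen (4 * n)); last by lia.
rewrite trisum_swap23; apply: dvd_trisum => //.
  by rewrite E5 [(n + _)%N]addnC E3 E4 E8 -EB; lia.
case: t st0 {neq1} => [|t] st0; last first.
  apply: (@prime_dvd_dixsum 2 (logn 2 n).+1) => //; first exact: pfactor_dvdn_mul.
    by rewrite addnn -mul2n pfactor_dvdn_mul.
  by rewrite -{2}[n]mul1n pfactor_ndvdn_mul.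
case: s st0 => // s _; rewrite [nseq s.+2 _]/= -[nseq 1 n ++ _]cat1s catA.
apply: (@prime_dvd_dixsum 2 (logn 2 (2 * n)).+1) => //.
- by rewrite (_ : 4 * n = 2 * (2 * n))%N ?pfactor_dvdn_mul //; lia.
- by rewrite addnn -mul2n pfactor_dvdn_mul //; lia.
- by rewrite -{2}[(2 * n)%N]mul1n pfactor_ndvdn_mul //; lia.
Qed.

Theorem mainTheorem4 (r s t n : nat)
    (hr : (0 < r)%N) (hs : (0 < s)%N) (ht : (0 < t)%N) (hn : (0 < n)%N) :
  [/\ (\sum_(k <- zrange (- n%:Z) n%:Z)
          (-1) ^ k * zbin (6 * n) ((3 * n)%N%:Z + k) ^+ r
                   * zbin (4 * n) ((2 * n)%N%:Z + k) ^+ s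
                   * zbin (2 * n) (n%:Z + k) ^+ t
        = 0 %[mod (2 * 'C(6 * n, n))%N%:Z])%Z,
      (\sum_(k <- zrange (- n%:Z) n%:Z)
          (-1) ^ k * zbin (6 * n) ((3 * n)%N%:Z + k) ^+ r
                   * zbin (4 * n) ((2 * n)%N%:Z + k) ^+ s
                   * zbin (2 * n) (n%:Z + k) ^+ t
        = 0 %[mod (6 * 'C(6 * n, 3 * n))%N%:Z])%Z &
      (r, s, t) <> (1%N, 1%N, 1%N) ->
      (\sum_(k <- zrange (- n%:Z) n%:Z)
          (-1) ^ k * zbin (8 * n) ((4 * n)%N%:Z + k) ^+ r
                   * zbin (4 * n) ((2 * n)%N%:Z + k) ^+ s
                   * zbin (2 * n) (n%:Z + k) ^+ t
        = 0 %[mod (2 * 'C(8 * n, 3 * n))%N%:Z])%Z].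
Proof.
case: r hr => // r _; case: s hs => // s _; case: t ht => // t _.
have S m a : (m = 2 * a)%N -> (n <= a)%N ->
    \sum_(k <- zrange (- n%:Z) n%:Z)
       (-1) ^ k * zbin m (a%:Z + k) ^+ r.+1
                * zbin (4 * n) ((2 * n)%N%:Z + k) ^+ s.+1
                * zbin (2 * n) (n%:Z + k) ^+ t.+1
      = trisum n a r.+1 (2 * n) s.+1 n t.+1.
  by move=> -> le_na; rewrite -sum_zrange_trisum ?mulnA //; lia.
split=> [||neq1]; rewrite S; try lia; rewrite mod0z; apply/dvdz_mod0P.
- exact: dvd_trisum_6n_n.
- exact: dvd_trisum_6n_3n.
- exact: dvd_trisum_8n_3n.
Qed.
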